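(* Fix a time $t$ and consider a junction with incoming roads $1,\ldots,n$ and outgoing roads $n+1,\ldots,n+m$, with the $\alpha$-inside Godunov fluxes. Assume that for each $i\in\{1,\ldots,n\}$ one of the following conditions is satisfied: 1. $u_{hi}^-(b_i)\ge u_*$ and $u_{hj}^+(a_j)\le\tilde{u}_j$ for all $j\in\{n+1,\ldots,n+m\}$, where $\tilde{u}_j\ge u_*$ is such that $f(\tilde{u}_j)=\alpha_{j,i}f(u_* )$. 2. $u_{hi}^-(b_i)<u_*$ and $u_{hj}^+(a_j)\le\tilde{u}_j$ for all $j\in\{n+1,\ldots,n+m\}$, where $\tilde{u}_j>u_*$ is such that $f(\tilde{u}_j)=\alpha_{j,i}f(u_{hi}^-(b_i))$. (The values $\tilde u_j$ may depend on $i$.) Then $E_j=0$ for all $j\in\{n+1,\ldots,n+m\}$.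
   Context: Junction: $n,m\ge 1$; each road $k\in\{1,\ldots,n+m\}$ is an interval $[a_k,b_k]$; roads $1,\ldots,n$ are incoming (the junction is at their right endpoint $b_i$) and roads $n+1,\ldots,n+m$ are outgoing (the junction is at their left endpoint $a_j$). The traffic distribution coefficients $\alpha_{j,i}$ ($i=1,\ldots,n$, $j=n+1,\ldots,n+m$) satisfy $0\le\alpha_{j,i}\le1$ and $\sum_{j=n+1}^{n+m}\alpha_{j,i}=1$ for every $i$. Discrete densities: $u_{hk}$ is the discrete (DG) density on road $k$, at each time a piecewise polynomial function on $[a_k,b_k]$ with respect to a finite partition of $[a_k,b_k]$. The time $t$ is fixed and omitted from the notation. $u_{hi}^-(b_i)$ is the left-sided limit of $u_{hi}$ at $b_i$ and $u_{hj}^+(a_j)$ is the right-sided limit of $u_{hj}$ at $a_j$. Flux: $f\in C^1(\mathbb{R})$ has a global maximum at $u_*$, is non-decreasing on $(-\infty,u_*]$ and non-increasing on $[u_*,\infty)$. Set $f_{in}(u^-)=f(u^-)$ if $u^-<u_*$ and $f_{in}(u^-)=f(u_* )$ if $u^-\ge u_*$; $f_{out}(u^+)=f(u_* )$ if $u^+\le u_*$ and $f_{out}(u^+)=f(u^+)$ if $u^+>u_*$. The Godunov flux with three variables is $H(u^-,u^+,\alpha)=\min\{\alpha f_{in}(u^-),f_{out}(u^+)\}$. $\alpha$-inside Godunov junction fluxes: $H_j=\sum_{i=1}^n H(u_{hi}^-(b_i),u_{hj}^+(a_j),\alpha_{j,i})$ for $j=n+1,\ldots,n+m$ and $H_i=\sum_{j=n+1}^{n+m}H(u_{hi}^-(b_i),u_{hj}^+(a_j),\alpha_{j,i})$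 for $i=1,\ldots,n$. Traffic distribution error: $E_j=H_j-\sum_{i=1}^n\alpha_{j,i}H_i$ for $j=n+1,\ldots,n+m$. *)

(* Defs.v *)
From mathcomp Require Import all_boot all_order all_algebra.
From mathcomp Require Import all_classical all_reals all_analysis.
Import Order.TTheory GRing.Theory Num.Theory.
Import numFieldNormedType.Exports.

Set Implicit Arguments.
Unset Strict Implicit.
Unset Printing Implicit Defensive.

Local Open Scope classical_set_scope.
Local Open Scope ring_scope.

(* Partition of [a, b] in the sense of [itv_partition]: the nodes are the
   strictly increasing sequence a :: s, whose last element is b. The values of
   u at the nodes are unconstrained, since a discontinuous piecewise polynomial
   is in general two-valued there. *)
Definition piecewise_polynomial (R : realType) (a b : R) (u : R -> R) : Prop :=
  exists2 s : seq R, itv_partition a b s &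
    forall k, (k < size s)%N ->
      exists p : {poly R},
        {in `]nth b (a :: s) k, nth b s k[, forall x, u x = p.[x]}.

Definition left_trace (R : realType) (u : R -> R) (x : R) : R :=
  lim (u y @[y --> x^'-]).

Definition right_trace (R : realType) (u : R -> R) (x : R) : R :=
  lim (u y @[y --> x^'+]).

(* [lim] is total; these two facts show that the traces used below are genuine
   one-sided limits. *)
Lemma is_cvg_left_trace (R : realType) (a b : R) (u : R -> R) :
  a < b -> piecewise_polynomial a b u -> cvg (u y @[y --> b^'-]).
Proof.
move=> ab [s [ps /eqP ls] H].
have s0 : (0 < size s)%N by case: s ps ls H => //= _ E; rewrite E ltxx in ab.
have ks : ((size s).-1 < size s)%N by rewrite prednK.
have [p Hp] := H _ ks.
have nb : nth b s (size s).-1 = b.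
  by rewrite nth_last; case: (s) s0 ls.
set c := nth b (a :: s) (size s).-1 in Hp.
have cb : c < b.
  by rewrite -[ltRHS]nb; apply: (pathP b ps).
apply/cvg_ex; exists p.[b].
apply: (@cvg_trans _ ((fun x => p.[x]) @ b^'-)); last first.
  by apply: cvg_at_left_filter; exact: continuous_horner.
apply: near_eq_cvg; near=> x.
apply/esym/Hp; rewrite nb in_itv /=; apply/andP; split; near: x.
  exact: nbhs_left_gt.
exact: nbhs_left_lt.
Unshelve. all: by end_near. Qed.

Lemma is_cvg_right_trace (R : realType) (a b : R) (u : R -> R) :
  a < b -> piecewise_polynomial a b u -> cvg (u y @[y --> a^'+]).
Proof.
move=> ab [[|c s] [ps /eqP ls] H]; first by rewrite -ls /= ltxx in ab.
have [p /= Hp] := H 0%N isT.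
move: ps => /= /andP[ac _].
apply/cvg_ex; exists p.[a].
apply: (@cvg_trans _ ((fun x => p.[x]) @ a^'+)); last first.
  by apply: cvg_at_right_filter; exact: continuous_horner.
apply: near_eq_cvg; near=> x.
apply/esym/Hp; rewrite in_itv /=; apply/andP; split; near: x.
  exact: nbhs_right_gt.
exact: nbhs_right_lt.
Unshelve. all: by end_near. Qed.

(* Roads are indexed by 'I_(n + m): [lshift m i] is the i-th incoming road,
   [rshift n j] the j-th outgoing one. Road k is the interval [a k, b k]. *)
Definition in_trace (R : realType) (n m : nat) (b : 'I_(n + m) -> R)
    (u : 'I_(n + m) -> R -> R) (i : 'I_n) : R :=
  left_trace (u (lshift m i)) (b (lshift m i)).

Definition out_trace (R : realType) (n m : nat) (a : 'I_(n + m) -> R)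
    (u : 'I_(n + m) -> R -> R) (j : 'I_m) : R :=
  right_trace (u (rshift n j)) (a (rshift n j)).

Definition f_in (R : realType) (f : R -> R) (ustar um : R) : R :=
  if um < ustar then f um else f ustar.

Definition f_out (R : realType) (f : R -> R) (ustar up : R) : R :=
  if up <= ustar then f ustar else f up.

Definition godunov (R : realType) (f : R -> R) (ustar um up alpha : R) : R :=
  Num.min (alpha * f_in f ustar um) (f_out f ustar up).

(* [um i] and [up j] are the traces at the junction; [alpha j i] is the share of
   the traffic from incoming road i that goes to outgoing road j. *)
Definition out_flux (R : realType) (n m : nat) (f : R -> R) (ustar : R)
    (alpha : 'I_m -> 'I_n -> R) (um : 'I_n -> R) (up : 'I_m -> R)
    (j : 'I_m) : R :=
  \sum_(i < n) godunov f ustar (um i) (up j) (alpha j i).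

Definition in_flux (R : realType) (n m : nat) (f : R -> R) (ustar : R)
    (alpha : 'I_m -> 'I_n -> R) (um : 'I_n -> R) (up : 'I_m -> R)
    (i : 'I_n) : R :=
  \sum_(j < m) godunov f ustar (um i) (up j) (alpha j i).

Definition distribution_error (R : realType) (n m : nat) (f : R -> R)
    (ustar : R) (alpha : 'I_m -> 'I_n -> R) (um : 'I_n -> R) (up : 'I_m -> R)
    (j : 'I_m) : R :=
  out_flux f ustar alpha um up j
  - \sum_(i < n) alpha j i * in_flux f ustar alpha um up i.

(* Main.v *)
Require Import Defs.
From mathcomp Require Import all_boot all_order all_algebra.
From mathcomp Require Import all_classical all_reals all_analysis.
Import Order.TTheory GRing.Theory Num.Theory.
Import numFieldNormedType.Exports.
Local Open Scope classical_set_scope.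
Local Open Scope ring_scope.

(* Under either condition, demand never exceeds supply: every three-variable flux
   is its first argument alpha_{j,i} f_in(u_i^-). Since the alpha_{j,i} sum to 1
   over j, the flux out of road i is then f_in(u_i^-), and it is split exactly
   according to alpha. *)

(** For [up <= ustar] the supply is the maximum of [f]; otherwise [up] and [utilde] both lie on the
    non-increasing branch. This turns the bound on the outgoing trace into a lower bound on the
    supply. *)
Lemma le_f_out (R : realType) (f : R -> R) (ustar utilde up : R)
  (f_max : forall x, f x <= f ustar)
  (f_nonincr : {in `[ustar, +oo[ &, forall x y, x <= y -> f y <= f x}) :
  ustar <= utilde -> up <= utilde -> f utilde <= f_out f ustar up.
Proof.
move=> ustar_le up_le; rewrite /f_out; case: (leP up ustar) => [_|ustar_lt]; first exact: f_max.
by apply: f_nonincr => //; rewrite in_itv /= andbT // ltW.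
Qed.

Lemma distribution_error_eq0 (R : realType) (n m : nat) (f : R -> R) (ustar : R)
  (alpha : 'I_m -> 'I_n -> R) (um : 'I_n -> R) (up : 'I_m -> R)
  (alpha_sum : forall i, \sum_(j < m) alpha j i = 1)
  (demand_le : forall i j,
     alpha j i * f_in f ustar (um i) <= f_out f ustar (up j)) :
  forall j, distribution_error f ustar alpha um up j = 0.
Proof.
have fluxE i j : godunov f ustar (um i) (up j) (alpha j i)
    = alpha j i * f_in f ustar (um i) by exact/min_idPl.
(* The error cancels separately for each incoming road [i]: its flux into [j] is the share
   [alpha j i] of its whole outflow. *)
move=> j; apply/eqP; rewrite subr_eq0; apply/eqP/eq_bigr => i _.
rewrite fluxE /in_flux (eq_bigr _ (fun k _ => fluxE i k)).
by rewrite -mulr_suml alpha_sum mul1r.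
Qed.

Theorem theorem3 (R : realType) (n m : nat) (hn : (1 <= n)%N) (hm : (1 <= m)%N)
  (a b : 'I_(n + m) -> R) (hab : forall k, a k < b k)
  (alpha : 'I_m -> 'I_n -> R)
  (halpha : forall j i, 0 <= alpha j i <= 1)
  (halpha_sum : forall i, \sum_(j < m) alpha j i = 1)
  (f : R -> R) (ustar : R)
  (f_derivable : forall x, derivable f x 1)
  (f_C1 : continuous (f^`())%classic)
  (f_max : forall x, f x <= f ustar)
  (f_nondecr : {in `]-oo, ustar] &, forall x y, x <= y -> f x <= f y})
  (f_nonincr : {in `[ustar, +oo[ &, forall x y, x <= y -> f y <= f x})
  (uh : R -> 'I_(n + m) -> R -> R) (t : R)
  (huh : forall k, piecewise_polynomial (a k) (b k) (uh t k))
  (hcond : forall i : 'I_n,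
    (ustar <= in_trace b (uh t) i /\
     exists utilde : 'I_m -> R, forall j : 'I_m,
       [/\ ustar <= utilde j,
           f (utilde j) = alpha j i * f ustar
         & out_trace a (uh t) j <= utilde j])
    \/
    (in_trace b (uh t) i < ustar /\
     exists utilde : 'I_m -> R, forall j : 'I_m,
       [/\ ustar < utilde j,
           f (utilde j) = alpha j i * f (in_trace b (uh t) i)
         & out_trace a (uh t) j <= utilde j])) :
  forall j : 'I_m,
    distribution_error f ustar alpha
      (in_trace b (uh t)) (out_trace a (uh t)) j = 0.
Proof.
apply: distribution_error_eq0 => // i j.
(* In both cases [f (utilde j)] is exactly the demand [alpha j i * f_in f ustar (um i)]: [f_in] is
   [f ustar] when the incoming trace is at least [ustar], and [f] of that trace when it is below. *)
case: (hcond i) => [[um_ge [utilde hu]] | [um_lt [utilde hu]]];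
  have [ut_ge fut up_le] := hu j.
- by rewrite /f_in ltNge um_ge -fut; exact: le_f_out.
- by rewrite /f_in um_lt -fut; apply: le_f_out => //; exact: ltW.
Qed.
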